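(* Let $X,Y$ be normed spaces, let $\varphi:X\times Y\to(-\infty,\infty]$ and $G:X\rightrightarrows Y$, and let $\mu(x)=\inf\{\varphi(x,y)\mid y\in G(x)\}$ and $M(x)=\{y\in G(x)\mid\varphi(x,y)=\mu(x)\}$. Let $\mu$ be finite at some $\bar x\in\operatorname{dom}M$, and let $\bar y\in M(\bar x)$. Suppose that the following two conditions are fulfilled. ($\mathcal A_1$) The sets $C:=\operatorname{epi}\varphi$ and $D:=\operatorname{gph}G\times\mathbb R$ satisfy the metric qualification condition $(Q_2)$ with respect to $\widehat\partial$ at $\bar w:=(\bar x,\bar y,\varphi(\bar x,\bar y))$, i.e., there exists $a>0$ such that $$\widehat\partial d(\cdot,C\cap D)(\bar w)\subset a\,\widehat\partial d(\cdot,C)(\bar w)+a\,\widehat\partial d(\cdot,D)(\bar w).$$ ($\mathcal A_2$) At least one of the following holds: (a) $G$ is semilocally nearly-isolated calm at $(\bar x,\bar y)$; (b) $G$ is locally nearly-isolated calm at $(\bar x,\bar y)$, and for every $\varepsilon>0$ there exists $\gamma>0$ such that $\mu(x)=\inf_{y\in G(x)}\varphi(x,y)=\inf_{y\in G(x)\cap\mathbb B(\bar y,\varepsilon)}\varphi(x,y)$ for all $x\in\mathbb B(\bar x,\gamma)$; (c) the solution mapping $M:\operatorname{dom}G\rightrightarrows Y$ admits an upper Lipschitzian selection at $(\bar x,\bar y)$. Then $$\widehat\partial\mu(\bar x)=\bigcup_{(x^*,y^* )\in\widehat\partial\varphi(\bar x,\bar y)}\big[x^*+\widehat D^*G(\bar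 x,\bar y)(y^* )\big],$$ $$\widehat\partial^{\infty}\mu(\bar x)=\bigcup_{(x^*,y^* )\in\widehat\partial^{\infty}\varphi(\bar x,\bar y)}\big[x^*+\widehat D^*G(\bar x,\bar y)(y^* )\big].$$
   Context: All spaces are normed; $X^*$ is the topological dual of $X$; $\mathbb B(\bar x,r)$ is the open ball, $\overline{\mathbb B}_Y$ is the closed unit ball of $Y$; product spaces carry the sum norm, e.g. $\|(x,y)\|=\|x\|+\|y\|$; $d(z,S)$ is the distance from $z$ to the set $S$. For $F:X\rightrightarrows Y$, $\operatorname{dom}F=\{x\mid F(x)\neq\emptyset\}$ and $\operatorname{gph}F=\{(x,y)\mid y\in F(x)\}$; for an extended-real-valued $f$ on $Z$, $\operatorname{epi}f=\{(z,\alpha)\in Z\times\mathbb R\mid\alpha\ge f(z)\}$. The infimum over the empty set is $+\infty$. Regular subdifferential: for $f$ finite at $\bar z$, $\widehat\partial f(\bar z)$ is the set of $z^*\in Z^*$ such that for every $\varepsilon>0$ there is $\gamma>0$ with $f(z)-f(\bar z)-\langle z^*,z-\bar z\rangle\ge-\varepsilon\|z-\bar z\|$ for all $z\in\mathbb B(\bar z,\gamma)$. Regular normal cone: for $S\subset Z$ and $\bar z\in S$, $\widehat N(\bar z;S)=\{z^*\in Z^*\mid \limsup_{z\to\bar z,\,z\in S}\langle z^*,\frac{z-\bar z}{\|z-\bar z\|}\rangle\le0\}$. Singular regular subdifferential: for $f$ finite at $\bar z$, $\widehat\partial^{\infty}f(\bar z)=\{z^*\in Z^*\mid(z^*,0)\in\widehat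 N((\bar z,f(\bar z));\operatorname{epi}f)\}$. Regular coderivative: for $(\bar x,\bar y)\in\operatorname{gph}G$ and $y^*\in Y^*$, $\widehat D^*G(\bar x,\bar y)(y^* )=\{x^*\in X^*\mid (x^*,-y^* )\in\widehat N((\bar x,\bar y);\operatorname{gph}G)\}$. Nearly-isolated calmness at $(\bar x,\bar y)\in\operatorname{gph}F$: $F:X\rightrightarrows Y$ is locally nearly-isolated calm if there are $L>0$, $\gamma>0$ with $F(u)\cap\mathbb B(\bar y,\gamma)\subset\{\bar y\}+L\|u-\bar x\|\overline{\mathbb B}_Y$ for all $u\in\mathbb B(\bar x,\gamma)\setminus\{\bar x\}$; it is semilocally nearly-isolated calm if there are $L>0$, $\gamma>0$ with $F(u)\subset\{\bar y\}+L\|u-\bar x\|\overline{\mathbb B}_Y$ for all $u\in\mathbb B(\bar x,\gamma)\setminus\{\bar x\}$. Upper Lipschitzian selection: $F:D_0\rightrightarrows Y$, $D_0\subset X$, admits an upper Lipschitzian selection at $(\bar x,\bar y)\in\operatorname{gph}F$ if there is a single-valued $h:D_0\to Y$ with $h(\bar x)=\bar y$, $h(x)\in F(x)$ for all $x\in D_0$ in a neighborhood of $\bar x$, and $h$ calm at $\bar x$, i.e., there are $r>0$, $\ell\ge0$ with $\|h(x)-h(\bar x)\|\le\ell\|x-\bar x\|$ for all $x\in\mathbb B(\bar x,r)\cap D_0$. *)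

(* Defs.v *)
From HB Require Import structures.
From mathcomp Require Import all_boot all_order all_algebra.
From mathcomp Require Import all_classical all_reals all_analysis.

Set Implicit Arguments.
Unset Strict Implicit.
Unset Printing Implicit Defensive.

Import Order.TTheory GRing.Theory Num.Theory.
Import numFieldNormedType.Exports.

Local Open Scope classical_set_scope.
Local Open Scope ring_scope.

(* The library norms [X * Y] by the maximum. [l1prod X Y] is an alias of
   [X * Y] that carries the sum norm and the topology of that norm. *)
Definition l1prod (X Y : Type) : Type := (X * Y)%type.

Section L1Prod.
Context {R : realType} (X Y : normedModType R).

HB.instance Definition _ := GRing.Lmodule.copy (l1prod X Y) (X * Y)%type.

Let l1norm (z : l1prod X Y) : R := `|z.1| + `|z.2|.

Let l1norm_triangle (z w : l1prod X Y) : l1norm (z + w) <= l1norm z + l1norm w.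
Proof. by rewrite /l1norm addrACA lerD// ler_normD. Qed.

Let l1normZ (a : R) (z : l1prod X Y) : l1norm (a *: z) = `|a| * l1norm z.
Proof. by rewrite /l1norm !normrZ mulrDr. Qed.

Let l1norm_eq0 (z : l1prod X Y) : l1norm z = 0 -> z = 0.
Proof.
case: z => x y; rewrite /l1norm /= => /eqP.
by rewrite paddr_eq0// !normr_eq0 => /andP[/eqP-> /eqP->].
Qed.

HB.instance Definition _ := Lmodule_isNormed.Build R (l1prod X Y)
  l1norm_triangle l1normZ l1norm_eq0.

Lemma l1prod_normE (z : l1prod X Y) : `|z| = `|z.1| + `|z.2|.
Proof. by []. Qed.

End L1Prod.

Section Dual.
Context {R : realType}.

(* The topological dual, as a set of functions. *)
Definition dual (Z : normedModType R) : set (Z -> R^o) :=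
  [set zs | linear zs /\ continuous zs].

(* The functional on the product that the pair (x*, y* ) represents. *)
Definition dual_pair (X Y : normedModType R) (xs : X -> R^o) (ys : Y -> R^o) :
    l1prod X Y -> R^o :=
  fun z => xs z.1 + ys z.2.

(* The set of pairs (x*, y* ) in X* x Y* that represent the elements of A,
   a subset of the dual of the product. *)
Definition dual_pairs (X Y : normedModType R) (A : set (l1prod X Y -> R^o)) :
    set ((X -> R^o) * (Y -> R^o)) :=
  [set p | [/\ dual p.1, dual p.2 & A (dual_pair p.1 p.2)]].

End Dual.

Section Subdifferentials.
Context {R : realType}.

Definition epi (Z : normedModType R) (f : Z -> \bar R) :
    set (l1prod Z R^o) :=
  [set p | (f p.1 <= (p.2 : R)%:E)%E].

(* Empty unless [f zbar] is finite; likewise for [singular_subdiff]. *)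
Definition regular_subdiff (Z : normedModType R) (f : Z -> \bar R) (zbar : Z) :
    set (Z -> R^o) :=
  [set zs | [/\ dual zs, f zbar \is a fin_num &
    forall eps : R, 0 < eps -> exists2 gamma : R, 0 < gamma &
      forall z, ball zbar gamma z ->
        ((- (eps * `|z - zbar|))%:E <=
          f z - f zbar - (zs (z - zbar) : R)%:E)%E]].

(* Empty unless [zbar] is in [S]. The limit superior is over the points of [S]
   that differ from [zbar]; it is -oo if [zbar] is isolated in [S]. *)
Definition regular_normal (Z : normedModType R) (S : set Z) (zbar : Z) :
    set (Z -> R^o) :=
  [set zs | [/\ dual zs, S zbar &
    (limf_esup (fun z => (zs (`|z - zbar|^-1 *: (z - zbar)) : R)%:E)
       (within S zbar^') <= 0)%E]].

Definition singular_subdiff (Z : normedModType R) (f : Z -> \bar R) (zbar : Z) :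
    set (Z -> R^o) :=
  [set zs | [/\ dual zs, f zbar \is a fin_num &
    regular_normal (epi f) (zbar, fine (f zbar))
      (dual_pair zs (fun _ : R^o => 0))]].

(* The metric qualification condition (Q_2) with respect to the regular
   subdifferential. *)
Definition metric_qualification (Z : normedModType R) (C D : set Z)
    (wbar : Z) : Prop :=
  exists2 a : R, 0 < a &
    regular_subdiff (edist_inf (C `&` D)) wbar `<=`
    [set (fun w => a * u w + a * v w) |
      u in regular_subdiff (edist_inf C) wbar &
      v in regular_subdiff (edist_inf D) wbar].

End Subdifferentials.

Section SetValuedMaps.
Context {R : realType} (X Y : normedModType R).
Implicit Types (F G : X -> set Y) (D : set X) (phi : l1prod X Y -> \bar R).

Definition dom F : set X := [set x | F x !=set0].

Definition gph F : set (l1prod X Y) := [set z | F z.1 z.2].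

Definition regular_coderivative G (xbar : X) (ybar : Y) (ys : Y -> R^o) :
    set (X -> R^o) :=
  [set xs | dual xs /\
    regular_normal (gph G) (xbar, ybar) (dual_pair xs (fun y => - ys y))].

(* {ybar} + rho B, where B is the closed unit ball. *)
Definition dilated_ball (ybar : Y) (rho : R) : set Y :=
  [set ybar + rho *: b | b in closed_ball_ Num.norm (0 : Y) 1].

Definition locally_nearly_isolated_calm F (xbar : X) (ybar : Y) : Prop :=
  exists L gamma : R, [/\ 0 < L, 0 < gamma &
    forall u, (ball xbar gamma `\ xbar) u ->
      F u `&` ball ybar gamma `<=` dilated_ball ybar (L * `|u - xbar|)].

Definition semilocally_nearly_isolated_calm F (xbar : X) (ybar : Y) : Prop :=
  exists L gamma : R, [/\ 0 < L, 0 < gamma &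
    forall u, (ball xbar gamma `\ xbar) u ->
      F u `<=` dilated_ball ybar (L * `|u - xbar|)].

(* The selection h : D -> Y is represented by a function on X whose values
   outside D are irrelevant when xbar is in D. *)
Definition upper_Lipschitzian_selection D F (xbar : X) (ybar : Y) : Prop :=
  exists h : X -> Y, [/\ h xbar = ybar,
    (\forall x \near xbar, D x -> F x (h x)) &
    exists r l : R, [/\ 0 < r, 0 <= l &
      forall x, (ball xbar r `&` D) x ->
        `|h x - h xbar| <= l * `|x - xbar|]].

Definition optimal_value phi G (x : X) : \bar R :=
  ereal_inf [set phi (x, y) | y in G x].

Definition solution_map phi G (x : X) : set Y :=
  [set y | G x y /\ phi (x, y) = optimal_value phi G x].

End SetValuedMaps.

(* Main.v *)
(* Both formulas are one statement about a functional k on R, with k = - id for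
   the regular and k = 0 for the singular subdifferential: (x*, k) is normal to
   epi mu iff ((x*, 0), k) is normal to the intersection of C = epi phi and
   D = gph G x R. The implication from the intersection to epi mu needs (A2),
   in the common form of its three cases that near-minimizing y in G x can be
   found with |y - ybar| <= L |x - xbar|. In a normed space the regular
   subdifferential of d(., S) at a point of S consists of the regular normals of
   norm at most 1, so after rescaling (Q_2) splits ((x*, 0), k) into a normal to
   C and a normal to D. The latter vanishes on the factor R, and comparing
   components gives the coderivative. *)
Require Import Defs.
From HB Require Import structures.
From mathcomp Require Import all_boot all_order all_algebra.
From mathcomp Require Import all_classical all_reals all_analysis.
From mathcomp Require Import ring lra.

Set Implicit Arguments.
Unset Strict Implicit.
Unset Printing Implicit Defensive.

Import Order.TTheory GRing.Theory Num.Theory.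
Import numFieldNormedType.Exports.

Local Open Scope classical_set_scope.
Local Open Scope ring_scope.

(** * Bounded functionals and their components on products *)

Section DualTheory.
Context {R : realType}.
Implicit Types X Y Z : normedModType R.

Lemma linear_fun0 Z (u : Z -> R^o) : linear u -> u 0 = 0.
Proof.
move=> /(_ (-1) 0 0); rewrite scaleN1r addr0 oppr0 => ->.
by rewrite scaleN1r addNr.
Qed.

Lemma linear_funZ Z (u : Z -> R^o) (a : R) z : linear u -> u (a *: z) = a * u z.
Proof. by move=> lu; rewrite -[a *: z]addr0 lu linear_fun0// addr0. Qed.

Lemma linear_fun_scalar (u : R^o -> R^o) r : linear u -> u r = r * u 1.
Proof.
by move=> lu; rewrite -(linear_funZ r (1 : R^o) lu) /GRing.scale/= mulr1.
Qed.

Lemma linear_funD Z (u : Z -> R^o) z w : linear u -> u (z + w) = u z + u w.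
Proof. by move=> lu; rewrite -[z in LHS]scale1r lu scale1r. Qed.

(** Later radii are chosen from the explicit bound; [K] is positive so that [K^-1] can rescale [u]
    into the dual unit ball. *)
Lemma dualP Z (u : Z -> R^o) : dual u <->
  linear u /\ exists2 K : R, 0 < K & forall z, `|u z| <= K * `|z|.
Proof.
split=> [[lu cu]|[lu [K K0 uK]]]; split=> //.
  pose f : {linear Z -> R^o} := HB.pack u (GRing.isLinear.Build R Z R^o _ u lu).
  have /linear_bounded_continuous/linear_boundedP : continuous f := cu.
  by move=> /pinfty_ex_gt0[K K0 fK]; exists K.
pose f : {linear Z -> R^o} := HB.pack u (GRing.isLinear.Build R Z R^o _ u lu).
apply: (@bounded_linear_continuous _ _ _ f); apply/linear_boundedP.
apply: filterS (nbhs_pinfty_ge (num_real K)) => r Kr x.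
by rewrite (le_trans (uK x))// ler_wpM2r.
Qed.

Lemma dual_linear Z (u : Z -> R^o) : dual u -> linear u.
Proof. by case. Qed.

Lemma dualD Z (u v : Z -> R^o) : dual u -> dual v -> dual (fun z => u z + v z).
Proof.
move=> [lu cu] [lv cv]; split=> [a z w|]; last first.
  by move=> z; apply: cvgD; [exact: cu|exact: cv].
by rewrite lu lv scalerDr addrACA.
Qed.

Lemma dualZ Z (a : R) (u : Z -> R^o) : dual u -> dual (fun z => a * u z).
Proof.
move=> [lu cu]; split=> [b z w|]; last by move=> z; apply: cvgMr; exact: cu.
by rewrite lu mulrDr; congr (_ + _); rewrite /GRing.scale/= mulrCA.
Qed.

Lemma dualN Z (u : Z -> R^o) : dual u -> dual (fun z => - u z).
Proof.
by move=> du; rewrite (_ : (fun _ => _) = fun z => -1 * u z);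
  [exact: dualZ | apply/funext => z; rewrite mulN1r].
Qed.

Lemma dual0 Z : dual (fun _ : Z => 0 : R^o).
Proof.
by split=> [a z w|z]; [rewrite scaler0 addr0 | exact: cvg_cst].
Qed.

Lemma dual_id : dual (fun r : R^o => r).
Proof. by split=> // z; exact: cvg_id. Qed.

Lemma dual_dual_pair X Y (xs : X -> R^o) (ys : Y -> R^o) :
  dual xs -> dual ys -> dual (dual_pair xs ys).
Proof.
move=> /dualP[lx [K K0 xK]] /dualP[ly [L L0 yL]]; apply/dualP; split.
  by move=> a z w; rewrite /dual_pair lx ly scalerDr addrACA.
exists (K + L) => [|[x y]]; first exact: addr_gt0.
rewrite l1prod_normE /dual_pair/= (le_trans (ler_normD _ _))//.
rewrite mulrDl lerD//.
  by rewrite (le_trans (xK x))// ler_pM2l// lerDl.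
by rewrite (le_trans (yL y))// ler_pM2l// lerDr.
Qed.

Lemma dual_fst X Y (u : l1prod X Y -> R^o) : dual u ->
  dual (fun x => u (x, 0)).
Proof.
move=> /dualP[lu [K K0 uK]]; apply/dualP; split.
  move=> a z w; rewrite -lu; congr u.
  by congr (_, _) => /=; rewrite scaler0 addr0.
by exists K => // x; rewrite (le_trans (uK _))// l1prod_normE/= normr0 addr0.
Qed.

Lemma dual_snd X Y (u : l1prod X Y -> R^o) : dual u ->
  dual (fun y => u (0, y)).
Proof.
move=> /dualP[lu [K K0 uK]]; apply/dualP; split.
  move=> a z w; rewrite -lu; congr u.
  by congr (_, _) => /=; rewrite scaler0 addr0.
by exists K => // x; rewrite (le_trans (uK _))// l1prod_normE/= normr0 add0r.
Qed.

Lemma dual_pairE X Y (u : l1prod X Y -> R^o) : linear u ->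
  dual_pair (fun x => u (x, 0)) (fun y => u (0, y)) = u.
Proof.
move=> lu; apply/funext => -[x y]; rewrite /dual_pair/= -linear_funD//.
by congr u; congr (_, _) => /=; rewrite ?addr0 ?add0r.
Qed.

End DualTheory.

(** * Calculus of regular normals: distance functions, epigraphs, products with the line *)

Section NormalTheory.
Context {R : realType}.
Implicit Types Z : normedModType R.

(** Multiplying by the norm of [z - zbar] clears the quotient in the limit superior; at the excluded
    point [zbar] both sides vanish, so it may be readmitted. *)
Lemma regular_normalP Z (S : set Z) (zbar : Z) (u : Z -> R^o) :
  regular_normal S zbar u <-> [/\ dual u, S zbar &
    forall e : R, 0 < e -> exists2 d : R, 0 < d &
      forall z, S z -> `|z - zbar| < d -> u (z - zbar) <= e * `|z - zbar|].
Proof.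
split=> -[du Sz Hu]; split=> //; have lu := dual_linear du.
  move=> e e0.
  have : (limf_esup (fun z => (u (`|z - zbar|^-1 *: (z - zbar)) : R)%:E)
       (within S zbar^') < e%:E)%E by rewrite (le_lt_trans Hu)// lte_fin.
  move=> /ereal_inf_lt[_ [V FV <-]] Ve.
  have /nbhs_ballP[d /= d0 dV] : nbhs zbar [set z | z != zbar -> S z -> V z] := FV.
  exists d => // z Sz' zd.
  have [->|zz] := eqVneq z zbar.
    by rewrite subrr linear_fun0// normr0 mulr0.
  have nz : 0 < `|z - zbar| by rewrite normr_gt0 subr_eq0.
  have Vz : V z.
    by apply: dV => //; rewrite -ball_normE/= distrC.
  have : ((u (`|z - zbar|^-1 *: (z - zbar)) : R)%:E <= e%:E)%E.
    by apply: (le_trans _ (ltW Ve)); apply: ereal_sup_ubound; exists z.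
  by rewrite lee_fin linear_funZ// mulrC ler_pdivrMr.
apply/lee_addgt0Pr => e e0; rewrite add0e.
have [d d0 dH] := Hu e e0.
(* [limf_esup] is an infimum over the members of the filter, so the supremum over one punctured ball
   in [S] bounds it. *)
apply: (@le_trans _ _ (ereal_sup
  ((fun z => (u (`|z - zbar|^-1 *: (z - zbar)) : R)%:E)
     @` [set z | S z /\ `|z - zbar| < d /\ z != zbar]))).
  apply: ereal_inf_lbound; eexists; last reflexivity.
  apply/nbhs_ballP; exists d => //= z.
  by rewrite -ball_normE/= distrC.
apply: ge_ereal_sup => _ [z [Sz' [zd zz]] <-].
have nz : 0 < `|z - zbar| by rewrite normr_gt0 subr_eq0.
by rewrite lee_fin linear_funZ// mulrC ler_pdivrMr// dH.
Qed.

(** Each summand gets half of the tolerance. The converse splitting is what (Q_2) supplies. *)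
Lemma regular_normalD Z (S T : set Z) zbar (u v : Z -> R^o) :
  regular_normal S zbar u -> regular_normal T zbar v ->
  regular_normal (S `&` T) zbar (fun z => u z + v z).
Proof.
move=> /regular_normalP[du Sz Hu] /regular_normalP[dv Tz Hv].
apply/regular_normalP; split=> [|//|e e0]; first exact: dualD.
have e20 : 0 < e / 2 by rewrite divr_gt0.
have [d d0 Hd] := Hu _ e20; have [d' d'0 Hd'] := Hv _ e20.
exists (Num.min d d') => [|z [Sz' Tz']]; first by rewrite lt_min d0.
rewrite lt_min => /andP[zd zd'].
have := Hd z Sz' zd; have := Hd' z Tz' zd'; lra.
Qed.

Lemma regular_normalZ Z (S : set Z) zbar (a : R) (u : Z -> R^o) : 0 < a ->
  regular_normal S zbar u -> regular_normal S zbar (fun z => a * u z).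
Proof.
move=> a0 /regular_normalP[du Sz Hu].
apply/regular_normalP; split=> [|//|e e0]; first exact: dualZ.
have [d d0 Hd] := Hu _ (divr_gt0 e0 a0).
exists d => // z Sz' zd.
by rewrite -ler_pdivlMl// mulrA [a^-1 * e]mulrC Hd.
Qed.

Lemma ball_dist Z (z w : Z) (r : R) : ball z r w = (`|w - z| < r) :> Prop.
Proof. by rewrite -ball_normE/= distrC. Qed.

Lemma lee_subEFin (x : \bar R) (a b c : R) :
  (a%:E <= x - b%:E - c%:E)%E = ((a + b + c)%:E <= x)%E.
Proof.
case: x => [x||].
- by rewrite -!EFinB !lee_fin; apply/idP/idP; lra.
- have -> : (+oo - b%:E - c%:E = +oo :> \bar R)%E by [].
  by rewrite !leey.
- by [].
Qed.

Lemma edist_norm Z (z w : Z) : edist (z, w) = `|z - w|%:E.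
Proof.
apply/eqP; rewrite eq_le; apply/andP; split.
  apply/lee_addgt0Pr => e e0; apply: ereal_inf_lbound.
  exists (`|z - w| + e) => //=.
  by split; [rewrite ltr_wpDl | rewrite -ball_normE/= ltrDl].
apply: le_ereal_inf_tmp => _ [r [r0 +] <-].
by rewrite -ball_normE/= lee_fin => /ltW.
Qed.

Lemma edist_inf_mem Z (S : set Z) z : S z -> edist_inf S z = 0%:E.
Proof. exact: edist_inf0. Qed.

(** The distance vanishes on [S], so the subgradient inequality tested on [S] is the normal
    inequality. *)
Lemma subdiff_dist_regular_normal Z (S : set Z) zbar (u : Z -> R^o) :
  S zbar -> regular_subdiff (edist_inf S) zbar u -> regular_normal S zbar u.
Proof.
move=> Sz [du _ Hu]; apply/regular_normalP; split=> // e e0.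
have [d d0 Hd] := Hu e e0; exists d => // z Sz' zd.
have : ball zbar d z by rewrite ball_dist.
move=> /Hd; rewrite !edist_inf_mem// -!EFinB lee_fin; lra.
Qed.

(* [K^-1] brings the normal into the dual unit ball. *)
Lemma regular_normal_subdiff_dist Z (S : set Z) zbar (u : Z -> R^o) (K : R) :
  0 < K -> (forall z, `|u z| <= K * `|z|) -> regular_normal S zbar u ->
  regular_subdiff (edist_inf S) zbar (fun z => K^-1 * u z).
Proof.
move=> K0 uK /(regular_normalZ (a := K^-1)); rewrite invr_gt0 => /(_ K0).
set v : Z -> R^o := fun z => K^-1 * u z.
have vle z : v z <= `|z|.
  by rewrite /v ler_pdivrMl// (le_trans (ler_norm _)).
move=> /regular_normalP[dv Sz Hv].
have lv := dual_linear dv.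
split=> //; first by rewrite edist_inf0.
(* Below, [w] in [S] is within twice the norm of [z - zbar] from [zbar]: [t <= e / 4] then costs at
   most half of the allowed error, and the radius [d / 3] keeps [w] within [d]. *)
move=> e e0; pose t := Num.min 1 (e / 4).
have t0 : 0 < t by rewrite lt_min ltr01 divr_gt0.
have t1 : t <= 1 by rewrite ge_min lexx.
have te : t * 4 <= e by rewrite -ler_pdivlMr// ge_min lexx orbT.
have [d d0 Hd] := Hv t t0.
exists (d / 3) => [|z]; first by rewrite divr_gt0.
rewrite ball_dist (edist_inf_mem Sz) lee_subEFin => zd.
have [->|zz] := eqVneq z zbar.
  rewrite subrr normr0 mulr0 (linear_fun0 lv) edist_inf_mem// !addr0.
  by rewrite oppr0.
have nz : 0 < `|z - zbar| by rewrite normr_gt0 subr_eq0.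
(* A violation yields [w] in [S] very close to [z]. Splitting [v (z - zbar)] at [w], the norm bounds
   [v (z - w)] and normality bounds [v (w - zbar)], which is contradictory. *)
rewrite leNgt; apply/negP.
move=> /ereal_inf_lt[_ [w Sw <-]]; rewrite edist_norm lte_fin => zw.
have vz := vle (z - zbar).
have wz : `|w - zbar| <= `|z - w| + `|z - zbar|.
  by rewrite [`|z - w|]distrC (le_trans _ (ler_normD _ _))// addrA subrK.
have enz : 0 < e * `|z - zbar| by exact: mulr_gt0.
have wd : `|w - zbar| < d by lra.
have := Hd w Sw wd.
have vzw := vle (z - w).
have : v (z - zbar) = v (z - w) + v (w - zbar).
  by rewrite -linear_funD// addrA subrK.
have : t * `|w - zbar| <= t * (2 * `|z - zbar|) by rewrite ler_pM2l//; lra.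
have : t * 4 * `|z - zbar| <= e * `|z - zbar| by rewrite ler_pM2r.
nra.
Qed.

(** Forward, [f z <= r] on the epigraph suffices. Conversely, where the subgradient inequality
    fails, the point at the height that it prescribes lies in the epigraph and contradicts
    normality. *)
Lemma regular_subdiff_epi Z (f : Z -> \bar R) zbar (u : Z -> R^o) :
  regular_subdiff f zbar u <-> [/\ dual u, f zbar \is a fin_num &
    regular_normal (epi f) (zbar, fine (f zbar)) (dual_pair u (fun r => - r))].
Proof.
split=> -[du fz Hu]; split=> //.
  apply/regular_normalP; split.
  - by apply: dual_dual_pair => //; apply: dualN; exact: dual_id.
  - by rewrite /epi/= fineK.
  move=> e e0; have [d d0 Hd] := Hu e e0.
  exists d => // -[z r]; rewrite /epi/= l1prod_normE/= => fr zrd.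
  have : ball zbar d z.
    by rewrite ball_dist (le_lt_trans _ zrd)// lerDl.
  move=> /Hd H.
  have : ((- (e * `|z - zbar|))%:E <= r%:E - f zbar - (u (z - zbar) : R)%:E)%E.
    by rewrite (le_trans H)// !leeB.
  rewrite -(fineK fz) -!EFinB lee_fin /dual_pair/= => {}H.
  have : 0 <= e * `|r - fine (f zbar)| by rewrite mulr_ge0// ltW.
  rewrite mulrDr; lra.
move=> e e0; move/regular_normalP: Hu => [_ _ Hu].
have /dualP[lu [K K0 uK]] := du.
(* The displacement to [(z, r)] has sum norm at most [M] times that of [z - zbar]. Tolerance
   [e / (2 * M)] thus allows only half of the value that the functional takes there. *)
pose M := 1 + K + e.
have M0 : 0 < M by rewrite /M; lra.
have [d d0 Hd] := Hu (e / (2 * M)) (divr_gt0 e0 (mulr_gt0 (ltr0Sn R 1) M0)).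
exists (d / M) => [|z]; first exact: divr_gt0.
rewrite ball_dist ltr_pdivlMr// => zd.
rewrite -(fineK fz) lee_subEFin leNgt; apply/negP => fz_lt.
set r := _ + _ in fz_lt.
have [zz|zz] := eqVneq z zbar.
  have rE : r = fine (f zbar).
    by rewrite /r zz subrr normr0 (linear_fun0 lu); lra.
  by move: fz_lt; rewrite rE fineK// zz ltxx.
have nz : 0 < `|z - zbar| by rewrite normr_gt0 subr_eq0.
have rle : `|r - fine (f zbar)| <= (K + e) * `|z - zbar|.
  rewrite /r addrAC addrK (le_trans (ler_normD _ _))// normrN addrC mulrDl.
  by rewrite lerD// normrM normr_id (gtr0_norm e0).
have nle : `|z - zbar| + `|r - fine (f zbar)| <= M * `|z - zbar|.
  by rewrite /M; lra.
have := Hd (z, r) (ltW fz_lt).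
rewrite l1prod_normE/= => /(_ (le_lt_trans nle _)).
rewrite mulrC zd => /(_ erefl); rewrite /dual_pair/=.
have c0 : 0 <= e / (2 * M) by rewrite divr_ge0 ?ltW ?mulr_gt0.
move=> /le_trans/(_ (ler_wpM2l c0 nle)).
have -> : e / (2 * M) * (M * `|z - zbar|) = e * `|z - zbar| / 2.
  by field; rewrite gt_eqF.
have : 0 < e * `|z - zbar| by exact: mulr_gt0.
by rewrite /r; lra.
Qed.


Lemma regular_normal_setXT Z (S : set Z) zbar (r : R^o)
    (v : l1prod Z R^o -> R^o) :
  regular_normal (S `*` [set: R^o] : set (l1prod Z R^o)) (zbar, r) v ->
  regular_normal S zbar (fun z => v (z, 0)) /\ forall s, v (0, s) = 0.
Proof.
move=> /regular_normalP[dv [/= Sz _] Hv]; split.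
  apply/regular_normalP; split=> // [|e e0]; first exact: dual_fst.
  have [d d0 Hd] := Hv e e0; exists d => // z Sz' zd.
  have := Hd (z, r) (conj Sz' I); rewrite l1prod_normE/= subrr normr0 addr0.
  move=> /(_ zd) H; rewrite (_ : (_, _) = (z, r) - (zbar, r) :> l1prod Z R^o)//.
  by congr (_, _); rewrite /= subrr.
have lv := dual_linear (dual_snd dv).
suff v1 : v (0, 1) = 0.
  by move=> s; rewrite (linear_fun_scalar s lv) v1 mulr0.
(* Vertical moves of either sign stay in the product, so [v (0, 1)] and its opposite are both at
   most any [e > 0]. *)
have le_v1 (b : R) : `|b| = 1 -> b * v (0, 1) <= 0.
  move=> b1; apply/ler_addgt0Pr => e e0; rewrite add0r.
  have [d d0 Hd] := Hv e e0.
  have b0 : `|d / 2 * b| = d / 2 by rewrite normrM b1 mulr1 gtr0_norm ?divr_gt0.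
  have := Hd (zbar, r + d / 2 * b) (conj Sz I).
  rewrite l1prod_normE/= subrr normr0 add0r addrAC subrr add0r b0.
  rewrite (_ : (_, _) - _ = (0, d / 2 * b) :> l1prod Z R^o); last first.
    by congr (_, _); rewrite /= ?subrr// addrAC subrr add0r.
  have -> : v (0, d / 2 * b) = d / 2 * (b * v (0, 1)).
    by rewrite (linear_fun_scalar _ lv) mulrA.
  have d20 : 0 < d / 2 by rewrite divr_gt0.
  by rewrite [e * _]mulrC ler_pM2l// => -> //; lra.
apply/eqP; rewrite eq_le; apply/andP; split.
  by have := le_v1 1 (normr1 _); rewrite mul1r.
by have := le_v1 (-1); rewrite normrN normr1 mulN1r oppr_le0 => /(_ erefl).
Qed.

Lemma setXT_regular_normal Z (S : set Z) zbar (r : R^o) (u : Z -> R^o) :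
  regular_normal S zbar u ->
  regular_normal (S `*` [set: R^o] : set (l1prod Z R^o)) (zbar, r)
    (dual_pair u (fun=> 0)).
Proof.
move=> /regular_normalP[du Sz Hu]; apply/regular_normalP; split=> //.
  by apply: dual_dual_pair => //; exact: dual0.
move=> e e0; have [d d0 Hd] := Hu e e0; exists d => // -[z s] [/= Sz' _].
rewrite l1prod_normE /dual_pair/= addr0 => zsd.
rewrite (le_trans (Hd z Sz' _))//; first by rewrite (le_lt_trans _ zsd)// lerDl.
by rewrite ler_pM2l// lerDl.
Qed.

End NormalTheory.

(** * Normals to [epi mu] and to the intersection of [epi phi] with [D] *)

Section OptimalValue.
Context {R : realType} (X Y : normedModType R).
Variables (phi : l1prod X Y -> \bar R) (G : X -> set Y) (xbar : X) (ybar : Y).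
Let mu := optimal_value phi G.
Let wbar : l1prod (l1prod X Y) R^o := ((xbar, ybar), fine (phi (xbar, ybar))).
Let D : set (l1prod (l1prod X Y) R^o) := gph G `*` [set: R^o].

(** The strict level [t] handles unattained infima and the value -oo alike; where [mu x] is +oo the
    condition is vacuous. *)
Definition calm_minimizing : Prop := exists L gamma : R,
  [/\ 0 <= L, 0 < gamma & forall x, `|x - xbar| < gamma ->
    forall t, (mu x < t)%E -> exists y,
      [/\ G x y, `|y - ybar| <= L * `|x - xbar| & (phi (x, y) < t)%E]].

Lemma dilated_ball_norm (rho : R) (y : Y) : 0 <= rho ->
  dilated_ball ybar rho y -> `|y - ybar| <= rho.
Proof.
move=> rho0 [b]; rewrite /closed_ball_/= sub0r normrN => b1 <-.
by rewrite [ybar + _]addrC addrK normrZ ger0_norm// ler_piMr.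
Qed.

(** Near-isolated calmness says nothing at [xbar], but there [ybar] itself is a minimizer. *)
Lemma calm_minimizing_at_center L t : solution_map phi G xbar ybar ->
  (mu xbar < t)%E -> exists y,
    [/\ G xbar y, `|y - ybar| <= L * `|xbar - xbar| & (phi (xbar, y) < t)%E].
Proof.
by move=> [Gy phiE] tmu; exists ybar; rewrite !subrr !normr0 mulr0 phiE.
Qed.

Lemma semilocally_calm_minimizing : solution_map phi G xbar ybar ->
  semilocally_nearly_isolated_calm G xbar ybar -> calm_minimizing.
Proof.
move=> My [L [g [L0 g0 GL]]].
exists L, g; split=> // [|x xg t]; first exact: ltW.
have [->|xx] := eqVneq x xbar => mut.
  exact: calm_minimizing_at_center.
have [_ [y Gy <-] yt] := ereal_inf_lt mut; exists y; split=> //.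
apply: dilated_ball_norm; first by rewrite mulr_ge0// ltW.
by apply: (GL x _ y Gy); split; [rewrite ball_dist | exact/eqP].
Qed.

Lemma locally_calm_minimizing : solution_map phi G xbar ybar ->
  locally_nearly_isolated_calm G xbar ybar ->
  (forall eps : R, 0 < eps -> exists2 gamma : R, 0 < gamma &
    forall x, ball xbar gamma x ->
      mu x = ereal_inf [set phi (x, y) | y in G x `&` ball ybar eps]) ->
  calm_minimizing.
Proof.
(* Localizing the infimum to the calmness radius [g] makes the near-minimizers subject to the
   calmness bound. *)
move=> My [L [g [L0 g0 GL]]] /(_ g g0)[g' g'0 muE].
exists L, (Num.min g g'); split=> [||x]; rewrite ?lt_min ?g0 ?ltW//.
move=> /andP[xg xg'] t; have [->|xx] := eqVneq x xbar => mut.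
  exact: calm_minimizing_at_center.
move: mut; rewrite muE ?ball_dist// => /ereal_inf_lt[_ [y [Gy yg] <-] yt].
exists y; split=> //; apply: dilated_ball_norm; first by rewrite mulr_ge0// ltW.
by apply: (GL x _ y (conj Gy yg)); split; [rewrite ball_dist | exact/eqP].
Qed.

Lemma upper_Lipschitzian_calm_minimizing :
  upper_Lipschitzian_selection (dom G) (solution_map phi G) xbar ybar ->
  calm_minimizing.
Proof.
move=> [h [hx /nbhs_ballP[g /= g0 hM] [r [l [r0 l0 hl]]]]].
exists l, (Num.min g r); split=> // [|x]; rewrite lt_min ?g0//.
(* [mu x < t] excludes an empty [G x], so [x] is in the domain on which [h] selects exact
   minimizers. *)
move=> /andP[xg xr] t /[dup] mut /ereal_inf_lt[_ [y Gy _] _].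
have domx : dom G x by exists y.
have [Ghx phih] : solution_map phi G x (h x) by apply: hM; rewrite ?ball_dist.
exists (h x); split=> //; last by rewrite phih.
by rewrite -hx hl//; split=> //; rewrite ball_dist.
Qed.

Hypotheses (mu_fin : mu xbar \is a fin_num)
  (My : solution_map phi G xbar ybar).
Variables (k : R^o -> R^o) (dk : dual k).

Let phi_mu : phi (xbar, ybar) = mu xbar. Proof. by case: My. Qed.

(** Dropping [y] maps the intersection into [epi mu], leaves the functional unchanged and does not
    increase the distance to the base point. *)
Lemma regular_normal_epi_restriction (xs : X -> R^o) :
  regular_normal (epi mu) (xbar, fine (mu xbar)) (dual_pair xs k) -> dual xs ->
  regular_normal (epi phi `&` D) wbar (dual_pair (dual_pair xs (fun=> 0)) k).
Proof.
move=> /regular_normalP[_ _ H] dxs.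
apply/regular_normalP; split.
- by apply: dual_dual_pair => //; apply: dual_dual_pair => //; exact: dual0.
- by split; [rewrite /epi/= phi_mu fineK | split=> //; case: My].
move=> e e0; have [d d0 Hd] := H e e0; exists d => // -[[x y] r] [].
rewrite /epi/= => phir [Gxy _].
rewrite !l1prod_normE /dual_pair/= phi_mu addr0 => xyrd.
have mur : epi mu (x, r).
  by apply: le_trans phir; apply: ereal_inf_lbound; exists y.
have := Hd _ mur; rewrite l1prod_normE /dual_pair/=.
have := normr_ge0 (y - ybar) => y0 /(_ _)/le_trans; apply.
  by apply: le_lt_trans xyrd; lra.
by rewrite ler_pM2l//; lra.
Qed.

(** A point [(x, r)] of [epi mu] is lifted to [((x, y), r + t)] with [y] near-minimizing; the bound
    on [y] keeps the lift comparably close to [wbar]. *)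
Lemma regular_normal_restriction_epi (xs : X -> R^o) : calm_minimizing ->
  dual xs ->
  regular_normal (epi phi `&` D) wbar (dual_pair (dual_pair xs (fun=> 0)) k) ->
  regular_normal (epi mu) (xbar, fine (mu xbar)) (dual_pair xs k).
Proof.
move=> [L [g [L0 g0 HL]]] dxs /regular_normalP[_ _ H].
have /dualP[lk [K K0 kK]] := dk.
apply/regular_normalP; split.
- exact: dual_dual_pair.
- by rewrite /epi/= fineK.
(* Lifting multiplies the distance by at most [c], up to [t]; hence the tolerance [e / c]. *)
move=> e e0; pose c := 1 + L; have c0 : 0 < c by rewrite /c; lra.
have ec0 : 0 < e / c by rewrite divr_gt0.
have [d d0 Hd] := H _ ec0.
exists (Num.min g (d / (2 * c))) => [|[x r]].
  by rewrite lt_min g0 divr_gt0// mulr_gt0.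
rewrite /epi/= => mur; rewrite lt_min l1prod_normE /dual_pair/=.
rewrite ltr_pdivlMr ?mulr_gt0// => /andP[xrg xrd].
set n := `|x - xbar|; set m := `|r - fine (mu xbar)|.
have n0 : 0 <= n by exact: normr_ge0.
have m0 : 0 <= m by exact: normr_ge0.
apply/ler_addgt0Pr => b b0.
(* Raising the height by [t] costs at most [e / c * t] in the norm and [K * t] through [k], together
   at most the slack [b]; [t <= d / 4] keeps the lift within [d]. *)
pose t := Num.min (d / 4) (b / (e / c + K)).
have q0 : 0 < e / c + K by rewrite addr_gt0.
have t0 : 0 < t by rewrite lt_min !divr_gt0.
have td : t <= d / 4 by rewrite ge_min lexx.
have tb : t * (e / c + K) <= b by rewrite -ler_pdivlMr// ge_min lexx orbT.
have xg : n < g by rewrite (le_lt_trans _ xrg)// lerDl.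
have mut : (mu x < (r + t)%:E)%E by rewrite (le_lt_trans mur)// lte_fin ltrDl.
have [y [Gy yL phit]] := HL x xg _ mut.
have := Hd ((x, y), r + t) (conj (ltW phit) (conj Gy I)).
rewrite !l1prod_normE /dual_pair/= phi_mu addr0.
have mt : `|r + t - fine (mu xbar)| <= m + t.
  by rewrite addrAC (le_trans (ler_normD _ _))// (gtr0_norm t0).
have cle : n + `|y - ybar| + `|r + t - fine (mu xbar)| <= c * (n + m) + t.
  have : 0 <= L * m by exact: mulr_ge0.
  by rewrite /c -/n in yL *; lra.
have xyd : c * (n + m) + t < d by move: xrd; rewrite -/n -/m; lra.
move=> /(_ (le_lt_trans cle xyd))/le_trans/(_ (ler_wpM2l (ltW ec0) cle)).
rewrite [r + t - _]addrAC (linear_funD _ _ lk) mulrDr mulrA divfK ?gt_eqF//.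
have : `|k t| <= K * t by rewrite -{2}(gtr0_norm t0); exact: kK.
by rewrite ler_norml => /andP[kt _]; lra.
Qed.

Lemma normal_epi_optimal_value (xs : X -> R^o) : calm_minimizing ->
  metric_qualification (epi phi) D wbar ->
  dual xs /\ regular_normal (epi mu) (xbar, fine (mu xbar)) (dual_pair xs k) <->
  exists2 p : (X -> R^o) * (Y -> R^o),
    [/\ dual p.1, dual p.2 &
      regular_normal (epi phi) wbar (dual_pair (dual_pair p.1 p.2) k)] &
    exists2 u, regular_coderivative G xbar ybar p.2 u &
      (fun x => p.1 x + u x) = xs.
Proof.
move=> calm [a a0 Q]; split; last first.
  move=> [[p1 p2] [/= dp1 dp2 Np] [u [du Nu] <-]].
  split; first exact: dualD.
  apply: regular_normal_restriction_epi => //; first exact: dualD.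
  (* The sum of the two normals has no [Y] component: [p2] from [epi phi] cancels the [- p2] of the
     coderivative. *)
  have := regular_normalD Np
    (setXT_regular_normal (fine (phi (xbar, ybar))) Nu).
  congr regular_normal; apply/funext => -[[x y] r].
  by rewrite /dual_pair/= addr0 [LHS]addrAC; congr (_ + _); rewrite addrACA addrN.
move=> [dxs Nxs].
have := regular_normal_epi_restriction Nxs dxs.
set w := dual_pair (dual_pair _ _) k => Nw.
have [dw [Cw Dw] _] := Nw.
have /dualP[lw [K K0 wK]] := dw.
have /Q[u' Hu [v' Hv /= uvE]] := regular_normal_subdiff_dist K0 wK Nw.
(* The factor [K] undoes the rescaling before (Q_2), and [a] is the constant of (Q_2), so the scaled
   normals sum to [w]. *)
have Ka0 : 0 < K * a by exact: mulr_gt0.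
have := regular_normalZ Ka0 (subdiff_dist_regular_normal Cw Hu).
have := regular_normalZ Ka0 (subdiff_dist_regular_normal Dw Hv).
set v := (fun _ => _) => /[dup] -[dv _ _] /regular_normal_setXT[Nv v0].
set u := (fun _ => _) => /[dup] -[du _ _] Nu.
have uvw z : u z + v z = w z.
  have /(congr1 (fun f => K * f z)) := uvE.
  by rewrite mulVKf ?gt_eqF// => <-; rewrite /u /v mulrDr !mulrA.
have dfu := dual_fst du; have lfv := dual_linear (dual_fst dv).
have u1 x : u ((x, 0), 0) + v ((x, 0), 0) = xs x.
  by rewrite uvw /w /dual_pair/= addr0 (linear_fun0 (dual_linear dk)) addr0.
(* [w] vanishes on [Y], so the [Y] components are opposite, which is the sign in the
   coderivative. *)
have u2 y : u ((0, y), 0) = - v ((0, y), 0).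
  apply/eqP; rewrite -addr_eq0; apply/eqP; rewrite uvw /w /dual_pair/= addr0.
  rewrite (linear_fun0 (dual_linear dxs)) (linear_fun0 (dual_linear dk)).
  exact: addr0.
(* As [v] vanishes on the factor R, [u] carries all of [k]. *)
have u3 r : u (0, r) = k r.
  have := uvw (0, r); rewrite v0 addr0 => ->.
  by rewrite /w /dual_pair/= (linear_fun0 (dual_linear dxs)) !add0r.
exists (fun x => u ((x, 0), 0), fun y => u ((0, y), 0)) => /=.
  split; [exact: (dual_fst dfu) | exact: (dual_snd dfu) |].
  rewrite (dual_pairE (dual_linear dfu)).
  have -> : k = (fun r => u (0, r)) by apply/funext => r; rewrite u3.
  by rewrite (dual_pairE (dual_linear du)).
exists (fun x => v ((x, 0), 0)); last by apply/funext.
split; first exact: (dual_fst (dual_fst dv)).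
have -> : (fun y => - u ((0, y), 0)) = (fun y => v ((0, y), 0)).
  by apply/funext => y; rewrite u2 opprK.
by rewrite (dual_pairE lfv).
Qed.

End OptimalValue.

Theorem theorem4p4 (R : realType) (X Y : normedModType R)
    (phi : l1prod X Y -> \bar R) (G : X -> set Y) (xbar : X) (ybar : Y)
    (mu := optimal_value phi G) (M := solution_map phi G)
    (phi_gtNy : forall z, (-oo < phi z)%E)
    (mu_fin : mu xbar \is a fin_num)
    (xbar_dom : dom M xbar)
    (ybar_sol : M xbar ybar)
    (A1 : metric_qualification (epi phi)
            (gph G `*` [set: R^o] : set (l1prod (l1prod X Y) R^o))
            ((xbar, ybar), fine (phi (xbar, ybar))))
    (A2 : [\/ semilocally_nearly_isolated_calm G xbar ybar,
              locally_nearly_isolated_calm G xbar ybar /\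
              (forall eps : R, 0 < eps -> exists2 gamma : R, 0 < gamma &
                forall x, ball xbar gamma x ->
                  mu x =
                  ereal_inf [set phi (x, y) | y in G x `&` ball ybar eps])
            | upper_Lipschitzian_selection (dom G) M xbar ybar]) :
  regular_subdiff mu xbar =
    \bigcup_(p in dual_pairs (regular_subdiff phi (xbar, ybar)))
      [set (fun x => p.1 x + u x) |
        u in regular_coderivative G xbar ybar p.2] /\
  singular_subdiff mu xbar =
    \bigcup_(p in dual_pairs (singular_subdiff phi (xbar, ybar)))
      [set (fun x => p.1 x + u x) |
        u in regular_coderivative G xbar ybar p.2].
Proof.
have calm : calm_minimizing phi G xbar ybar.
  case: A2 => [?|[? ?]|?]; first exact: semilocally_calm_minimizing.
    exact: locally_calm_minimizing.
  exact: upper_Lipschitzian_calm_minimizing.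
have phi_fin : phi (xbar, ybar) \is a fin_num by case: ybar_sol => _ ->.
have rule k (dk : dual k) xs :=
  normal_epi_optimal_value mu_fin ybar_sol dk xs calm A1.
(* The first two inclusions use [k = - id], through [regular_subdiff_epi]; the last two use [k = 0],
   where the definition is already in terms of normals. *)
split; apply/seteqP; split=> xs.
- move=> /regular_subdiff_epi[dxs _ Nxs].
  have [p [dp1 dp2 Np] [u Hu <-]] :=
    (rule _ (dualN dual_id) xs).1 (conj dxs Nxs).
  exists p; last by exists u.
  by split=> //; apply/regular_subdiff_epi; split=> //; exact: dual_dual_pair.
- move=> [p [dp1 dp2 /regular_subdiff_epi[_ _ Np]] Hu].
  have [dxs Nxs] := (rule _ (dualN dual_id) xs).2
    (ex_intro2 _ _ p (And3 dp1 dp2 Np) Hu).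
  exact/regular_subdiff_epi.
- move=> [dxs _ Nxs].
  have [p [dp1 dp2 Np] [u Hu <-]] := (rule _ (@dual0 _ _) xs).1 (conj dxs Nxs).
  exists p; last by exists u.
  by split=> //; split=> //; exact: dual_dual_pair.
- move=> [p [dp1 dp2 [_ _ Np]] Hu].
  have [dxs Nxs] := (rule _ (@dual0 _ _) xs).2
    (ex_intro2 _ _ p (And3 dp1 dp2 Np) Hu).
  by split.
Qed.
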